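(* Let $m$, $n$ and $q$ be positive integers such that $q$ is even or $mnq$ is odd. Then \[ \sum_{k = 1}^\infty \frac{(-1)^{k-1}L_{nk+mnq}}{\prod_{j=0}^{2m} F_{nk+njq}} = \frac{1}{F_{mnq}}\sum_{k=1}^{q}\frac{(-1)^{k-1}}{\prod_{j=0}^{2m-1}F_{nk+njq}}. \]
   Context: The Fibonacci numbers are defined by $F_0=0$, $F_1=1$, $F_n=F_{n-1}+F_{n-2}$, and the Lucas numbers by $L_0=2$, $L_1=1$, $L_n=L_{n-1}+L_{n-2}$. Infinite sums are limits of partial sums. *)

(* Defs.v *)
From mathcomp Require Import all_boot.

Set Implicit Arguments.
Unset Strict Implicit.
Unset Printing Implicit Defensive.

Fixpoint fib (n : nat) : nat :=
  match n with
  | 0 => 0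
  | 1 => 1
  | (n'.+1 as n1).+1 => fib n1 + fib n'
  end.

Fixpoint lucas (n : nat) : nat :=
  match n with
  | 0 => 2
  | 1 => 1
  | (n'.+1 as n1).+1 => lucas n1 + lucas n'
  end.

(* Main.v *)
(** Put P k = \prod_(j < 2m) F_(nk + njq) and g k = (-1)^(k-1) / P k. The
    identity F_(x+2y) - (-1)^y F_x = F_y L_(x+y), with x = nk and y = mnq, turns
    F_(mnq) times the k-th summand into g k - g (k + q); the parity hypothesis is
    what makes (-1)^(mnq) equal to (-1)^q. The sum telescopes with step q, and
    g tends to 0. *)
Require Import Defs.
From mathcomp Require Import all_boot all_order all_algebra.
From mathcomp Require Import all_classical all_reals all_analysis.
From mathcomp Require Import zify ring.

Import Order.TTheory GRing.Theory Num.Theory.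
Import numFieldNormedType.Exports.
Local Open Scope classical_set_scope.
Local Open Scope ring_scope.

Lemma fibSS n : fib n.+2 = (fib n.+1 + fib n)%N.
Proof. by []. Qed.

Lemma lucasSS n : lucas n.+2 = (lucas n.+1 + lucas n)%N.
Proof. by []. Qed.

Lemma fib_gt0 n : (0 < n)%N -> (0 < fib n)%N.
Proof.
case: n => // n _; elim: n => // n IHn.
by rewrite fibSS addn_gt0 IHn.
Qed.

(** A crude linear growth bound is all the convergence needs; the factor 2 absorbs small cases such
    as [fib 2 = 1]. *)
Lemma leq_double_fib n : (n <= 2 * fib n)%N.
Proof.
have: (n <= 2 * fib n)%N && (n.+1 <= 2 * fib n.+1)%N; last by case/andP.
elim: n => // n /andP[IHn IHSn]; rewrite IHSn fibSS.
case: n IHn IHSn => // n _; have := @fib_gt0 n.+1 isT; lia.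
Qed.

Lemma fibD x y : fib (x + y).+1 = (fib x.+1 * fib y.+1 + fib x * fib y)%N.
Proof.
elim: x y => [|x IHx] y; first by rewrite add0n mul1n mul0n addn0.
by rewrite addSnnS IHx !fibSS; ring.
Qed.

Lemma lucas_fib n : (lucas n + fib n = 2 * fib n.+1)%N.
Proof.
have: (lucas n + fib n = 2 * fib n.+1)%N /\
      (lucas n.+1 + fib n.+1 = 2 * fib n.+2)%N; last by case.
elim: n => // n [IHn IHSn]; split=> //.
rewrite lucasSS !(fibSS n.+1) (fibSS n) in IHSn *; lia.
Qed.

Section FibRing.
Variable R : comRingType.
Implicit Types x y n : nat.

(** Here $F_{x-1}$ is written as $F_{x+1} - F_x$, so the addition formula also covers $x = 0$ and
    only uses consecutive values at $x$ and $y$. *)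
Lemma fibDr x y : (fib (x + y))%:R =
  (fib x)%:R * (fib y.+1)%:R + (fib x.+1)%:R * (fib y)%:R
  - (fib x)%:R * (fib y)%:R :> R.
Proof.
case: x => [|x]; first by rewrite add0n !mul0r mul1r add0r subr0.
by rewrite addSn fibD fibSS natrD !natrM natrD; ring.
Qed.

Lemma lucasE n : (lucas n)%:R = (fib n.+1)%:R *+ 2 - (fib n)%:R :> R.
Proof. by apply/eqP; rewrite eq_sym subr_eq -natrD lucas_fib mul2n -addnn natrD. Qed.

Lemma fib_cassini n :
  (fib n.+1)%:R ^+ 2 - (fib n.+1)%:R * (fib n)%:R - (fib n)%:R ^+ 2
  = (-1) ^+ n :> R.
Proof.
elim: n => [|n IHn]; first by rewrite expr1n mulr0 expr0n !subr0.
by rewrite fibSS natrD [RHS]exprS -IHn; ring.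
Qed.

(** Once Cassini's identity replaces $(-1)^y$, both sides are polynomials in $F_x, F_{x+1}, F_y,
    F_{y+1}$. *)
Lemma fib_mul_lucas x y :
  (fib y)%:R * (lucas (x + y))%:R
  = (fib (x + y + y))%:R - (-1) ^+ y * (fib x)%:R :> R.
Proof.
rewrite lucasE -fib_cassini (fibDr (x + y)) fibD !natrD !natrM fibDr; ring.
Qed.

End FibRing.

(** The sum of [g] over $[0, N+q)$ can be cut at $N$ or at $q$; comparing the two cuts gives the
    formula, with no order between [q] and [N] required. *)
Lemma sum_telescope_step (V : zmodType) (g : nat -> V) (q N : nat) :
  \sum_(0 <= i < N) (g i - g (i + q)%N)
  = \sum_(0 <= i < q) g i - \sum_(0 <= i < q) g (i + N)%N.
Proof.
have shift p r : \sum_(0 <= i < r) g (i + p)%N = \sum_(p <= i < r + p) g i.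
  by rewrite -{2}[p]add0n big_addn addnK.
rewrite sumrB !shift; apply/eqP; rewrite subr_eq addrAC eq_sym subr_eq.
by rewrite -!big_cat_nat ?leq_addl //= addnC.
Qed.

Section Summand.
Variables (R : realType) (m n q : nat).
Hypotheses (m_gt0 : (0 < m)%N) (n_gt0 : (0 < n)%N).

Let den k : R := \prod_(0 <= j < 2 * m) (fib (n * k + n * j * q))%:R.

(** Indexed by $i = k - 1$: this avoids [den 0], whose factor at $j = 0$ vanishes. *)
Definition tail_term (i : nat) : R := (-1) ^+ i / den i.+1.

Lemma fib_factor_gt0 k j : (0 < fib (n * k.+1 + n * j * q))%N.
Proof. by rewrite fib_gt0 // addn_gt0 muln_gt0 n_gt0. Qed.

(** Replacing [k] by [k + q] has the effect of raising [j] by one, so both sides are the product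
    over $0 \le j \le 2m$, with its last or its first factor split off. *)
Lemma den_shift k : den k * (fib (n * k + 2 * (m * n * q)))%:R
  = (fib (n * k))%:R * den (k + q).
Proof.
rewrite /den; set s := (2 * m)%N.
transitivity (\prod_(0 <= j < s.+1) (fib (n * k + n * j * q))%:R : R).
  by rewrite big_nat_recr //=; congr (_ * (fib _)%:R); rewrite /s; ring.
rewrite big_nat_recl // muln0 mul0n addn0; congr (_ * _).
by apply: eq_bigr => j _; congr (fib _)%:R; ring.
Qed.

Lemma den_gt0 k : 0 < den k.+1.
Proof. by apply: prodr_gt0 => j _; rewrite ltr0n fib_factor_gt0. Qed.

(** The factor at $j = 0$ alone reaches the bound, and the others are at least 1. *)
Lemma den_ge k : (k.+1)%:R / 2 <= den k.+1.
Proof.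
have fib_le_den : (fib (n * k.+1))%:R <= den k.+1.
  rewrite /den big_ltn ?muln_gt0 // muln0 mul0n addn0.
  rewrite ler_peMr //; elim/big_ind: _ => // [x y x1 y1|j _].
    by rewrite (le_trans x1) // ler_peMr // (le_trans ler01).
  by rewrite ler1n fib_factor_gt0.
rewrite (le_trans _ fib_le_den) // ler_pdivrMr // -natrM ler_nat mulnC.
by rewrite (leq_trans _ (leq_double_fib _)) // leq_pmull.
Qed.

Lemma tail_term_cvg0 : tail_term @ \oo --> (0 : R).
Proof.
apply/norm_cvg0P.
apply: (@squeeze_cvgr _ _ _ _ (fun=> 0) (fun i => 2 * harmonic i)).
- near=> i; rewrite normr_ge0 /= normrM normrX normrN1 expr1n mul1r.
  rewrite normfV gtr0_norm ?den_gt0 // -[2]invrK -invfM lef_pV2.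
  + by rewrite mulrC den_ge.
  + by rewrite posrE den_gt0.
  + by rewrite posrE mulr_gt0 ?invr_gt0.
- exact: cvg_cst.
- by rewrite -(mulr0 2); apply: cvgMl_tmp; exact: cvg_harmonic.
Unshelve. all: by end_near. Qed.

Lemma summandE i : ~~ odd q \/ odd (m * n * q) -> (0 < q)%N ->
  (-1) ^+ i * (lucas (n * i.+1 + m * n * q))%:R
    / \prod_(0 <= j < (2 * m).+1) (fib (n * i.+1 + n * j * q))%:R
  = 1 / (fib (m * n * q))%:R * (tail_term i - tail_term (i + q)).
Proof.
move=> parity q_gt0; set y := (m * n * q)%N.
(* If [q] is even, so is [y]; if [y] is odd, so is its divisor [q]. *)
have sign_yq : (-1) ^+ y = (-1) ^+ q :> R.
  rewrite -[LHS]signr_odd -[RHS]signr_odd /y; congr (_ ^+ nat_of_bool _).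
  by case: parity; rewrite !oddM; case: (odd q); rewrite ?andbF ?andbT // => ->.
have last_index : (n * i.+1 + n * (2 * m) * q = n * i.+1 + 2 * y)%N.
  by rewrite /y; ring.
rewrite big_nat_recr //= -/(den i.+1) last_index /tail_term -addSn.
have := den_shift i.+1; rewrite -/y.
have := fib_mul_lucas R (n * i.+1) y; rewrite -addnA addnn -mul2n sign_yq exprD.
have F0 k : (0 < k)%N -> (fib k)%:R != 0 :> R.
  by move=> k0; rewrite pnatr_eq0 -lt0n fib_gt0.
have y0 : (fib y)%:R != 0 :> R by rewrite F0 // /y !muln_gt0 m_gt0 n_gt0.
have x0 : (fib (n * i.+1))%:R != 0 :> R by rewrite F0 // muln_gt0 n_gt0.
have z0 : (fib (n * i.+1 + 2 * y))%:R != 0 :> R.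
  by rewrite F0 // addn_gt0 muln_gt0 n_gt0.
have d0 : den i.+1 != 0 by rewrite gt_eqF ?den_gt0.
have d1 : den (i.+1 + q) != 0 by rewrite gt_eqF ?den_gt0.
move=> luc dsh.
(* Solving [luc] for the Lucas number and [dsh] for the shifted product leaves an identity of
   rational functions. *)
have -> : (lucas (n * i.+1 + y))%:R = ((fib (n * i.+1 + 2 * y))%:R
    - (-1) ^+ q * (fib (n * i.+1))%:R) / (fib y)%:R :> R.
  by rewrite -luc mulrAC mulfV // mul1r.
have -> : den (i.+1 + q)
    = den i.+1 * (fib (n * i.+1 + 2 * y))%:R / (fib (n * i.+1))%:R.
  by rewrite dsh mulrAC mulfV // mul1r.
by field; rewrite x0 y0 z0 d0.
Qed.

End Summand.

Theorem theorem2p21 (R : realType) (m n q : nat)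
    (m_gt0 : (0 < m)%N) (n_gt0 : (0 < n)%N) (q_gt0 : (0 < q)%N)
    (parity : ~~ odd q \/ odd (m * n * q)) :
  (fun N : nat =>
     \sum_(1 <= k < N.+1)
       (-1) ^+ (k - 1) * (lucas (n * k + m * n * q))%:R
         / \prod_(0 <= j < (2 * m).+1) (fib (n * k + n * j * q))%:R : R)
    @ \oo -->
  1 / (fib (m * n * q))%:R *
    (\sum_(1 <= k < q.+1)
       (-1) ^+ (k - 1)
         / \prod_(0 <= j < 2 * m) (fib (n * k + n * j * q))%:R : R).
Proof.
set g := tail_term R m n q.
(* The [q] zeros are the limits of the [q] terms [g (i + N)], so the target matches the telescoped
   partial sum term by term. *)
have -> : (\sum_(1 <= k < q.+1) (-1) ^+ (k - 1)
    / \prod_(0 <= j < 2 * m) (fib (n * k + n * j * q))%:R : R)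
    = \sum_(0 <= i < q) g i - \sum_(0 <= i < q) 0.
  rewrite [X in _ - X]big1 // subr0 big_add1; apply: eq_bigr => i _.
  by rewrite subn1.
rewrite [X in X @ \oo --> _](_ : _ = fun N => 1 / (fib (m * n * q))%:R *
    (\sum_(0 <= i < q) g i - \sum_(0 <= i < q) g (i + N)%N)); last first.
  apply/funext => N; rewrite -sum_telescope_step mulr_sumr big_add1.
  by apply: eq_bigr => i _; rewrite subn1 summandE.
apply: cvgMl_tmp; apply: cvgB; first exact: cvg_cst.
(* The number of terms is fixed at [q], so the limit can be taken inside the sum. *)
apply: cvg_big => // [|i _]; first exact: add_continuous.
have := tail_term_cvg0 R m n q m_gt0 n_gt0; rewrite -(cvg_shiftn i).
by under eq_fun do rewrite addnC.
Qed.
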